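(* Let $\mathbb{D}$ be a discrete valuation ring with uniformizer $z$, and consider a causal $\mathbb{D}$-linear network code on a (possibly cyclic) network with $\omega$ source channels, with coding vectors $\mathbf{f}_e\in\mathbb{D}^\omega$. Let $v$ be a node at which the code is decodable, i.e. decodable with delay $\delta$ for some integer $\delta\ge 0$. Then the minimum decoding delay at $v$ (the least integer $\delta\ge 0$ such that the code is decodable at $v$ with delay $\delta$) is equal to the largest valuation among the invariant factors of the submodule $\langle \mathbf{f}_e : e\in In(v)\rangle$ of $\mathbb{D}^\omega$.
   Context: A discrete valuation ring (DVR) is a local principal ideal domain that is not a field; its uniformizer $z$ generates the unique maximal ideal, and every nonzero element is a unit times a power $z^k$, with $k$ its valuation. Network: a finite directed multigraph (cycles allowed) whose edges are called channels, with a distinguished source node having exactly $\omega\ge 1$ outgoing channels (the source channels). $In(v)$ is the set of incoming channels of a node $v$. An adjacent pair $(d,e)$ consists of a channel $d$ ending at the node from which the channel $e$ starts. A $\mathbb{D}$-linear network code ($\mathbb{D}$-LNC) assigns a coding coefficient $k_{d,e}\in\mathbb{D}$ to every adjacent pair $(d,e)$. It is causal if around every cycle of the network there is at least one adjacent pair $(d,e)$ with $k_{d,e}$ divisible by $z$. Causality guarantees a unique assignment of coding vectors $\mathbf{f}_e\in\mathbb{D}^\omega$ (column vectors) to the channels $e$ such that the coding vectors of the $\omega$ source channels form the natural basis of $\mathbb{D}^\omega$ and $\mathbf{f}_e=\sum_{d\in In(v)}k_{d,e}\mathbf{f}_d$ for every outgoing channel $e$ of every non-source node $v$. $[\mathbf{f}_e]_{e\in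 In(v)}$ denotes the $\omega\times|In(v)|$ matrix with columns $\mathbf{f}_e$, $e\in In(v)$. The code is decodable at $v$ with delay $\delta\ge 0$ if there is an $|In(v)|\times\omega$ matrix $\mathbf{A}$ over $\mathbb{D}$ with $[\mathbf{f}_e]_{e\in In(v)}\cdot\mathbf{A}=z^\delta\mathbf{I}$, where $\mathbf{I}$ is the $\omega\times\omega$ identity matrix. (This forces $[\mathbf{f}_e]_{e\in In(v)}$ to have full rank $\omega$.) Invariant factors: for a rank-$\omega$ submodule $N$ of $\mathbb{D}^\omega$ there are a basis $\{\mathbf{u}_1,\dots,\mathbf{u}_\omega\}$ of $\mathbb{D}^\omega$ and integers $0\le i_1\le\cdots\le i_\omega$ such that $z^{i_1}\mathbf{u}_1,\dots,z^{i_\omega}\mathbf{u}_\omega$ form a basis of $N$; the invariant factors of $N$ are $z^{i_1},\dots,z^{i_\omega}$, with valuations $i_1,\dots,i_\omega$. *)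

(* Defs.v *)
From HB Require Import structures.
From mathcomp Require Import all_boot all_order all_algebra.

Set Implicit Arguments.
Unset Strict Implicit.
Unset Printing Implicit Defensive.

Import GRing.Theory.
Local Open Scope ring_scope.

Section DiscreteValuationRing.

Variable D : idomainType.
Implicit Types (I J M : D -> Prop) (a x y z : D).

(* [divides a], as a predicate on D, is also the principal ideal (a). *)
Definition divides a x : Prop := exists b, x = b * a.

(* The unit ideal is allowed, unlike with mathcomp's [idealr_closed], and
   ideals are Prop-valued so that they need not be decidable. *)
Definition is_ideal I : Prop :=
  [/\ I 0, forall x y, I x -> I y -> I (x + y) & forall a x, I x -> I (a * x)].

Definition is_maximal_ideal M : Prop :=
  [/\ is_ideal M, ~ M 1 &
      forall J, is_ideal J -> (forall x, M x -> J x) -> ~ J 1 ->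
        forall x, J x -> M x].

Definition is_pid : Prop :=
  forall I, is_ideal I -> exists a, forall x, I x <-> divides a x.

Definition is_local : Prop :=
  exists M, is_maximal_ideal M /\
    forall M', is_maximal_ideal M' -> forall x, M' x <-> M x.

Definition is_field : Prop := forall x, x != 0 -> x \is a GRing.unit.

Definition is_dvr : Prop := [/\ is_local, is_pid & ~ is_field].

Definition is_uniformizer z : Prop := is_maximal_ideal (divides z).

End DiscreteValuationRing.

Arguments is_dvr : clear implicits.

(* A finite directed multigraph, with loops, parallel channels and cycles
   allowed. The outgoing channels of the source are labelled bijectively by
   'I_w, so there are exactly w of them; the label of a source channel says
   which vector of the natural basis it carries. *)
Record network (w : nat) := Network {
  node : finType;
  channel : finType;
  chan_from : channel -> node;
  chan_to : channel -> node;
  source : node;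
  src_chan : 'I_w -> channel;
  src_chan_inj : injective src_chan;
  src_chanP : forall e, (chan_from e == source) = (e \in codom src_chan)
}.

Section LinearNetworkCode.

Variables (D : idomainType) (w : nat) (G : network w).

Definition In (v : node G) : {set channel G} := [set e | chan_to e == v].

Definition adjacent : rel (channel G) :=
  fun d e => chan_to d == chan_from e.

(* Only the values at adjacent pairs are ever used below. *)
Definition lnc := channel G -> channel G -> D.

(* A cycle is a nonempty cyclic sequence of distinct channels in which
   consecutive channels are adjacent; it may visit a node more than once. *)
Definition causal (z : D) (k : lnc) : Prop :=
  forall c : seq (channel G), c != [::] -> ucycle adjacent c ->
    exists2 d, d \in c & divides z (k d (next c d)).

Definition is_coding_vectors (k : lnc) (f : channel G -> 'cV[D]_w) : Prop :=
  (forall i : 'I_w, f (src_chan G i) = delta_mx i ord0) /\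
  (forall e, chan_from e != source G ->
     f e = \sum_(d in In (chan_from e)) k d e *: f d).

Variables (z : D) (f : channel G -> 'cV[D]_w) (v : node G).

Definition coding_mx : 'M[D]_(w, #|In v|) :=
  \matrix_(i < w, j < #|In v|) f (enum_val j) i ord0.

Definition decodable (delta : nat) : Prop :=
  exists A : 'M[D]_(#|In v|, w), coding_mx *m A = (z ^+ delta)%:M.

Definition is_min_decoding_delay (delta : nat) : Prop :=
  decodable delta /\ forall delta', decodable delta' -> (delta <= delta')%N.

Definition coding_span (x : 'cV[D]_w) : Prop :=
  exists c : channel G -> D, x = \sum_(e in In v) c e *: f e.

End LinearNetworkCode.

Section InvariantFactors.

Variables (D : idomainType) (w : nat).

Definition is_basis (N : 'cV[D]_w -> Prop) (b : 'I_w -> 'cV[D]_w) : Prop :=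
  (forall x, N x <-> exists c : 'I_w -> D, x = \sum_(j < w) c j *: b j) /\
  (forall c : 'I_w -> D, \sum_(j < w) c j *: b j = 0 -> forall j, c j = 0).

(* The invariant factors of N are the z ^+ i j; in particular N is a
   submodule of rank w. *)
Definition invariant_valuations (z : D) (N : 'cV[D]_w -> Prop)
    (i : 'I_w -> nat) : Prop :=
  (forall j1 j2 : 'I_w, (j1 <= j2)%N -> (i j1 <= i j2)%N) /\
  exists u : 'I_w -> 'cV[D]_w,
    is_basis (fun _ => True) u /\ is_basis N (fun j => z ^+ i j *: u j).

End InvariantFactors.

(* Main.v *)
(** An integer [delta] is a decoding delay at [v] exactly when the span [N] of
    the incoming coding vectors contains [z ^+ delta *: x] for every [x]; in a
    basis adapted to [N] this says that every valuation [i j] is at most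
    [delta].

    Such a basis exists for any submodule [N] containing [z ^+ delta D^w], by
    induction on [w]: take the largest [k] with [N] inside [z ^+ k D^w] and
    write [N = z ^+ k N'].  Some vector of [N'] has a coordinate outside [(z)],
    and that coordinate is comaximal with every power of [z], so [N'] also has a
    vector with a coordinate equal to 1, which splits off both from [D^w] and
    from [N']. *)
Require Import Defs.
From HB Require Import structures.
From mathcomp Require Import all_boot all_order all_algebra.
From mathcomp Require Import ring.
From Stdlib Require Import Classical.

Set Implicit Arguments.
Unset Strict Implicit.
Unset Printing Implicit Defensive.

Import GRing.Theory.
Local Open Scope ring_scope.

(** * Powers of the uniformizer: divisibility and comaximality *)

Lemma uniformizer_neq0 (D : idomainType) (z : D) :
  is_uniformizer z -> ~ is_field D -> z != 0.
Proof.
move=> [_ _ zmax] nfield; apply/eqP => z0; apply: nfield => x x_neq0.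
apply/negPn/negP => x_nunit.
(* A nonunit [x] generates a proper ideal, which contains (z) because [z] is zero here; maximality
   then puts [x] in (z). *)
have [b xE] : divides z x.
  apply: (zmax (divides x)) => [|y [b ->]|[b /esym bx1]|].
  - split; first by exists 0; rewrite mul0r.
      by move=> _ _ [b ->] [c ->]; exists (b + c); rewrite mulrDl.
    by move=> a _ [b ->]; exists (a * b); rewrite mulrA.
  - by exists 0; rewrite z0 mulr0 mul0r.
  - by case/negP: x_nunit; apply/unitrPr; exists b; rewrite mulrC.
  - by exists 1; rewrite mul1r.
by move: x_neq0; rewrite xE z0 mulr0 eqxx.
Qed.

(** If [n < m], cancelling [z ^+ n] makes [z] divide 1, but a maximal ideal is proper. *)
Lemma divides_expz_leq (D : idomainType) (z : D) m n :
  is_uniformizer z -> z != 0 -> divides (z ^+ m) (z ^+ n) -> (m <= n)%N.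
Proof.
move=> [_ z_ndiv1 _] z_neq0 [b zE]; rewrite leqNgt; apply/negP => lt_nm.
apply: z_ndiv1; exists (b * z ^+ (m - n.+1)).
apply: (mulIf (expf_neq0 n z_neq0)); rewrite mul1r [LHS]zE.
by rewrite -!mulrA -exprS -exprD subnK.
Qed.

Lemma comaximal_expz (D : idomainType) (z y : D) m :
  is_uniformizer z -> ~ divides z y -> exists a b, a * z ^+ m + b * y = 1.
Proof.
move=> [_ _ zmax] z_ndivy.
(* The ideal generated by [z] and [y] is strictly larger than (z), so it must contain 1. *)
have [c [d cd1]] : exists c d, c * z + d * y = 1.
  apply: NNPP => notJ1; apply: z_ndivy.
  apply: (zmax (fun x => exists c d, c * z + d * y = x)) => //.
  - split; first by exists 0, 0; rewrite !mul0r addr0.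
      move=> _ _ [c [d <-]] [c' [d' <-]].
      by exists (c + c'), (d + d'); ring.
    by move=> a _ [c [d <-]]; exists (a * c), (a * d); ring.
  - by move=> _ [c ->]; exists c, 0; ring.
  - by exists 0, 1; ring.
elim: m => [|m [a [b ab1]]]; first by exists 1, 0; rewrite expr0; ring.
(* Multiplying [a * z ^+ m] by [c * z + d * y = 1] turns it into a multiple of [z ^+ m.+1] plus a
   multiple of [y]. *)
exists (a * c), (a * z ^+ m * d + b).
by rewrite -[RHS]ab1 -[in RHS](mulr1 (a * _)) -cd1 exprS; ring.
Qed.

(** * Splitting one coordinate off a submodule *)

Definition is_submodule (D : idomainType) w (N : 'cV[D]_w -> Prop) : Prop :=
  [/\ N 0, forall x y, N x -> N y -> N (x + y) & forall a x, N x -> N (a *: x)].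

(** The embedding of D^n as the hyperplane of D^(n+1) where coordinate [i0] vanishes, with left
    inverse [row' i0]. As a matrix, it inherits linearity from the laws of [mulmx]. *)
Definition insert_mx (D : idomainType) n (i0 : 'I_n.+1) : 'M[D]_(n.+1, n) :=
  \matrix_(i, j) (i == lift i0 j)%:R.

Lemma insert_mx_lift (D : idomainType) n (i0 : 'I_n.+1) (x : 'cV[D]_n) j :
  (insert_mx D i0 *m x) (lift i0 j) 0 = x j 0.
Proof.
rewrite mxE (bigD1 j) //= mxE eqxx mul1r big1 ?addr0 // => l /negPf l_neqj.
by rewrite mxE (inj_eq lift_inj) eq_sym l_neqj mul0r.
Qed.

Lemma insert_mx_hole (D : idomainType) n (i0 : 'I_n.+1) (x : 'cV[D]_n) :
  (insert_mx D i0 *m x) i0 0 = 0.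
Proof.
by rewrite mxE big1 // => l _; rewrite mxE (negPf (neq_lift _ _)) mul0r.
Qed.

Lemma insert_mxK (D : idomainType) n (i0 : 'I_n.+1) :
  cancel (mulmx (insert_mx D i0)) (@row' D n.+1 1 i0).
Proof.
by move=> x; apply/matrixP => i j; rewrite !ord1 [LHS]mxE insert_mx_lift.
Qed.

Lemma insert_mx_row' (D : idomainType) n (i0 : 'I_n.+1) (x : 'cV[D]_n.+1) :
  x i0 0 = 0 -> insert_mx D i0 *m row' i0 x = x.
Proof.
move=> x0; apply/matrixP => i j; rewrite ord1.
case: (unliftP i0 i) => [l ->|->]; last by rewrite insert_mx_hole.
by rewrite insert_mx_lift mxE.
Qed.

Lemma submodule_sum (D : idomainType) w (N : 'cV[D]_w -> Prop) (I : finType)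
    (c : I -> D) (u : I -> 'cV[D]_w) :
  is_submodule N -> (forall i, N (u i)) -> N (\sum_i c i *: u i).
Proof.
by move=> [N0 ND NZ] Nu; elim/big_ind: _ => // i _; apply: NZ.
Qed.

Lemma basis_mem (D : idomainType) w (N : 'cV[D]_w -> Prop) b j :
  is_basis N b -> N (b j).
Proof.
case=> [bspan _]; apply/bspan; exists (fun l => (l == j)%:R).
rewrite (bigD1 j) //= eqxx scale1r big1 ?addr0 // => l /negPf ->.
by rewrite scale0r.
Qed.

Definition cons_family (T : Type) n (a : T) (s : 'I_n -> T) (j : 'I_n.+1) : T :=
  oapp s a (unlift ord0 j).

Lemma cons_family0 (T : Type) n (a : T) (s : 'I_n -> T) :
  cons_family a s ord0 = a.
Proof. by rewrite /cons_family unlift_none. Qed.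

Lemma cons_familyS (T : Type) n (a : T) (s : 'I_n -> T) j :
  cons_family a s (lift ord0 j) = s j.
Proof. by rewrite /cons_family liftK. Qed.

(** As [y] has coordinate 1 at [i0], subtracting [x i0 0 *: y] from [x] lands in the hyperplane, so
    N is the direct sum of D y and its trace on the hyperplane. *)
Lemma is_basis_cons (D : idomainType) n (i0 : 'I_n.+1) (N : 'cV[D]_n.+1 -> Prop)
    (y : 'cV[D]_n.+1) (b : 'I_n -> 'cV[D]_n) :
  is_submodule N -> N y -> y i0 0 = 1 ->
  is_basis (fun x => N (insert_mx D i0 *m x)) b ->
  is_basis N (cons_family y (fun j => insert_mx D i0 *m b j)).
Proof.
move=> subN Ny y1 bbasis; have [N0 ND NZ] := subN.
have sumE (c : 'I_n.+1 -> D) :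
    \sum_j c j *: cons_family y (fun j => insert_mx D i0 *m b j) j =
    c ord0 *: y + insert_mx D i0 *m (\sum_j c (lift ord0 j) *: b j).
  rewrite big_ord_recl cons_family0 mulmx_sumr; congr (_ + _).
  by apply: eq_bigr => j _; rewrite cons_familyS scalemxAr.
have [bspan bfree] := bbasis.
split=> [x|c].
  split=> [Nx|[c ->]]; last first.
    apply: submodule_sum => // j; case: (unliftP ord0 j) => [l ->|->].
      by rewrite cons_familyS; apply: (basis_mem l bbasis).
    by rewrite cons_family0.
  pose x' := x - x i0 0 *: y.
  have x'E : insert_mx D i0 *m row' i0 x' = x'.
    by apply: insert_mx_row'; rewrite !mxE y1 mulr1 subrr.
  have : N (insert_mx D i0 *m row' i0 x').
    by rewrite x'E /x' -scaleNr; apply: ND => //; apply: NZ.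
  case/bspan => c cE; exists (cons_family (x i0 0) c).
  rewrite sumE cons_family0.
  under eq_bigr => j _ do rewrite cons_familyS.
  by rewrite -cE x'E addrC subrK.
rewrite sumE => c_sum0.
(* Only [y] contributes to coordinate [i0]. *)
have c0 : c ord0 = 0.
  move/matrixP/(_ i0 0): c_sum0.
  by rewrite mxE insert_mx_hole addr0 !mxE y1 mulr1.
move: c_sum0; rewrite c0 scale0r add0r => /(congr1 (row' i0)).
rewrite insert_mxK => sum0 j; case: (unliftP ord0 j) => [l ->|-> //].
apply: (bfree (fun j => c (lift ord0 j))).
by rewrite sum0; apply/matrixP => i i'; rewrite !mxE.
Qed.

Lemma is_basis_ext (D : idomainType) w (N N' : 'cV[D]_w -> Prop) b b' :
  (forall x, N x <-> N' x) -> b =1 b' -> is_basis N b -> is_basis N' b'.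
Proof.
move=> NN' bb' [bspan bfree].
have sumE c : \sum_j c j *: b' j = \sum_j c j *: b j.
  by apply: eq_bigr => j _; rewrite bb'.
split=> [x|c]; last by rewrite sumE => /bfree.
by rewrite -NN' bspan; split=> -[c ->]; exists c; rewrite sumE.
Qed.

Lemma is_basis_scale (D : idomainType) w (a : D) (N N' : 'cV[D]_w -> Prop) b :
  a != 0 -> (forall x, N x <-> exists2 x', x = a *: x' & N' x') ->
  is_basis N' b -> is_basis N (fun j => a *: b j).
Proof.
move=> a_neq0 NN' [bspan bfree].
have sumE c : \sum_j c j *: (a *: b j) = a *: \sum_j c j *: b j.
  by rewrite scaler_sumr; apply: eq_bigr => j _; rewrite !scalerA mulrC.
split=> [x|c]; last first.
  rewrite sumE => sum0; apply: bfree; apply/matrixP => i j.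
  move/matrixP/(_ i j): sum0; rewrite !mxE => /eqP.
  by rewrite mulf_eq0 (negPf a_neq0) => /eqP.
rewrite NN'; split=> [[_ -> /bspan [c ->]]|[c ->]].
  by exists c; rewrite sumE.
by rewrite sumE; exists (\sum_j c j *: b j) => //; apply/bspan; exists c.
Qed.

(** * Existence of the invariant factors *)

Lemma exists_last (P : nat -> Prop) n :
  P 0%N -> (forall k, P k -> (k <= n)%N) -> exists k, P k /\ ~ P k.+1.
Proof.
move=> P0 Pn; apply: NNPP => noLast.
have allP k : P k.
  by elim: k => // k Pk; apply: NNPP => nPk; apply: noLast; exists k.
by have := Pn _ (allP n.+1); rewrite ltnn.
Qed.

Lemma scaled_vectorP (D : idomainType) w (a : D) (x : 'cV[D]_w) :
  (forall i, divides a (x i 0)) -> exists y, x = a *: y.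
Proof.
move=> /fin_all_exists [y yE]; exists (\col_i y i).
by apply/matrixP => i j; rewrite !mxE ord1 yE mulrC.
Qed.

Lemma submodule_split (D : idomainType) (z : D) n (N : 'cV[D]_n.+1 -> Prop) m :
  is_uniformizer z -> z != 0 -> is_submodule N ->
  (forall x, N (z ^+ m *: x)) ->
  exists k y i0, [/\ (k <= m)%N, forall x, N x -> exists x', x = z ^+ k *: x',
    N (z ^+ k *: y) & y i0 0 = 1].
Proof.
move=> z_unif z_neq0 [N0 ND NZ] Nm.
pose P k := forall x, N x -> exists x', x = z ^+ k *: x'.
have Ple k : P k -> (k <= m)%N.
  (* Applied to [z ^+ m] times the all-ones vector, [P k] shows that [z ^+ k] divides [z ^+ m]. *)
  move=> /(_ _ (Nm (const_mx 1))) [x' /matrixP/(_ ord0 0)].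
  rewrite !mxE mulr1 => zE; apply: (divides_expz_leq z_unif z_neq0).
  by exists (x' ord0 0); rewrite mulrC.
have [|k [Pk nPk]] := exists_last _ Ple.
  by move=> x _; exists x; rewrite expr0 scale1r.
have [x [Nx nx]] : exists x, N x /\ ~ exists x', x = z ^+ k.+1 *: x'.
  apply: NNPP => nex; apply: nPk => x Nx; apply: NNPP => nx.
  by apply: nex; exists x.
have [y xE] := Pk _ Nx.
(* Were all coordinates of [y] divisible by [z], then [x] would be a multiple of [z ^+ k.+1]. *)
have [i0 ndiv] : exists i0, ~ divides z (y i0 0).
  apply: NNPP => nex; apply: nx.
  have [i|y' yE] := @scaled_vectorP _ _ z y.
    by apply: NNPP => ndiv; apply: nex; exists i.
  by exists y'; rewrite xE yE scalerA -exprSr.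
have [a [b ab1]] := comaximal_expz (m - k) z_unif ndiv.
(* The coordinate at [i0] is the comaximality relation, hence 1. After scaling by [z ^+ k], the
   first term is a multiple of [z ^+ m], so it lies in N by hypothesis, and the second is
   [b *: x]. *)
exists k, ((a * z ^+ (m - k)) *: delta_mx i0 0 + b *: y), i0; split=> //.
- exact: Ple.
- rewrite scalerDr; apply: ND; last first.
    by rewrite scalerA mulrC -scalerA -xE; apply: NZ.
  rewrite scalerA mulrCA -exprD subnKC ?Ple // -scalerA; exact: NZ.
- by rewrite !mxE !eqxx mulr1.
Qed.

Lemma exists_invariant_valuations (D : idomainType) (z : D) w
    (N : 'cV[D]_w -> Prop) m :
  is_uniformizer z -> z != 0 -> is_submodule N ->
  (forall x, N (z ^+ m *: x)) -> exists i, invariant_valuations z N i.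
Proof.
move=> z_unif z_neq0; elim: w N m => [|n IHn] N m subN Nm.
  have vec0 (x y : 'cV[D]_0) : x = y by apply/matrixP => -[].
  exists (fun=> 0%N); split=> //; exists (fun=> 0).
  have [N0 _ _] := subN.
  split; split=> [x|c _ []//]; split=> // _; try by exists (fun=> 0).
  by rewrite (vec0 x 0).
have [k [y [i0 [le_km Nk Ny y1]]]] := submodule_split z_unif z_neq0 subN Nm.
pose N' x := N (z ^+ k *: x).
have [N0 ND NZ] := subN.
have subN' : is_submodule N'.
  rewrite /N'; split=> [|x x'|a x]; rewrite ?scaler0 ?scalerDr //.
    exact: ND.
  by rewrite scalerA mulrC -scalerA; apply: NZ.
have [| |i [i_sorted [u [uT uN]]]] :=
    IHn (fun x => N' (insert_mx D i0 *m x)) (m - k)%N.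
- have [N'0 N'D N'Z] := subN'.
  split=> [|x x'|a x]; rewrite ?mulmx0 ?mulmxDr -?scalemxAr //.
    exact: N'D.
  exact: N'Z.
- by move=> x; rewrite /N' -scalemxAr scalerA -exprD subnKC.
(* Every vector of N is divisible by [z ^+ k], so the new valuation [k] is the smallest and goes
   first; undoing the division by [z ^+ k] shifts the others by [k]. *)
exists (cons_family k (fun j => k + i j)%N); split.
  move=> j1 j2; case: (unliftP ord0 j1) => [l1 ->|->];
    case: (unliftP ord0 j2) => [l2 ->|->];
    rewrite ?cons_familyS ?cons_family0 //.
    by rewrite leq_add2l => le_l; apply: i_sorted.
  by rewrite leq_addr.
exists (cons_family y (fun j => insert_mx D i0 *m u j)).
split; first exact: is_basis_cons uT.
apply: is_basis_ext (is_basis_scale (expf_neq0 k z_neq0) _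
  (is_basis_cons subN' Ny y1 uN)) => [x|j|x].
- exact: iff_refl.
- case: (unliftP ord0 j) => [l ->|->]; rewrite ?cons_familyS ?cons_family0 //.
  by rewrite -scalemxAr scalerA exprD.
- split=> [Nx|[x' -> //]].
  by have [x' xE] := Nk _ Nx; exists x' => //; rewrite /N' -xE.
Qed.

(** * Valuations, spans and decoding delays *)

Lemma invariant_valuations_leq (D : idomainType) (z : D) w
    (N : 'cV[D]_w -> Prop) i m :
  is_uniformizer z -> z != 0 -> invariant_valuations z N i ->
  (forall x, N (z ^+ m *: x)) <-> (forall j, (i j <= m)%N).
Proof.
move=> z_unif z_neq0 [_ [u [[uspan ufree] [Nspan _]]]]; split=> [Nm j|le_im x].
  have [c cE] := (Nspan _).1 (Nm (u j)).
  apply: (divides_expz_leq z_unif z_neq0); exists (c j).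
  (* Two expansions of [z ^+ m *: u j] in the basis [u] are compared: the one coming from N and the
     trivial one. *)
  have /(_ _ j) := ufree (fun l => c l * z ^+ i l - z ^+ m *+ (l == j)).
  rewrite eqxx mulr1n => c0; apply/esym/subr0_eq/c0.
  under eq_bigr => l _ do rewrite scalerBl -scalerA.
  rewrite sumrB -cE (bigD1 j) //= eqxx mulr1n big1 ?addr0 ?subrr // => l.
  by move=> /negPf ->; rewrite mulr0n scale0r.
have [c ->] := (uspan x).1 I; apply/Nspan.
(* The truncated subtraction is exact because [i j <= m]. *)
exists (fun j => c j * z ^+ (m - i j)).
rewrite scaler_sumr; apply: eq_bigr => j _.
by rewrite !scalerA -mulrA -exprD subnK // mulrC.
Qed.

Lemma coding_span_submodule (D : idomainType) w (G : network w)
    (f : channel G -> 'cV[D]_w) (v : node G) : is_submodule (coding_span f v).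
Proof.
split=> [|_ _ [c ->] [c' ->]|a _ [c ->]].
- by exists (fun=> 0); rewrite big1 // => e _; rewrite scale0r.
- exists (fun e => c e + c' e); rewrite -big_split.
  by apply: eq_bigr => e _; rewrite scalerDl.
- exists (fun e => a * c e); rewrite scaler_sumr.
  by apply: eq_bigr => e _; rewrite scalerA.
Qed.

Lemma coding_spanP (D : idomainType) w (G : network w)
    (f : channel G -> 'cV[D]_w) (v : node G) (x : 'cV[D]_w) :
  coding_span f v x <-> exists a, x = coding_mx f v *m a.
Proof.
have mulE a : coding_mx f v *m a = \sum_j a j 0 *: f (enum_val j).
  apply/matrixP => i j; rewrite ord1 !mxE summxE.
  by apply: eq_bigr => l _; rewrite !mxE mulrC.
split=> [[c ->]|[a ->]].
  exists (\col_j c (enum_val j)); rewrite mulE big_enum_val.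
  by apply: eq_bigr => j _; rewrite mxE.
rewrite mulE; apply: submodule_sum; first exact: coding_span_submodule.
move=> j; exists (fun e => (e == enum_val j)%:R).
rewrite (bigD1 (enum_val j)) ?enum_valP //= eqxx scale1r big1 ?addr0 //.
by move=> e /andP[_ /negPf ->]; rewrite scale0r.
Qed.

Lemma decodableP (D : idomainType) (z : D) w (G : network w)
    (f : channel G -> 'cV[D]_w) (v : node G) m :
  decodable z f v m <-> forall x, coding_span f v (z ^+ m *: x).
Proof.
split=> [[A FA] x|span].
  by apply/coding_spanP; exists (A *m x); rewrite mulmxA FA mul_scalar_mx.
(* The columns of the decoding matrix are preimages of the vectors [z ^+ m *: delta_mx j 0], one
   chosen for each [j]. *)
have [a aE] : exists a : 'I_w -> 'cV[D]_#|In v|,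
    forall j, z ^+ m *: delta_mx j 0 = coding_mx f v *m a j.
  apply: (@fin_all_exists _ _
    (fun j a => z ^+ m *: delta_mx j 0 = coding_mx f v *m a)) => j.
  exact/coding_spanP.
exists (\matrix_(l, j) a j l 0); apply/matrixP => i j.
move/matrixP/(_ i 0): (aE j); rewrite !mxE andbT mulr_natr => ->.
by apply: eq_bigr => l _; rewrite !mxE.
Qed.

Theorem theorem3 (D : idomainType) (z : D)
    (D_dvr : is_dvr D) (z_unif : is_uniformizer z)
    (w : nat) (w_ge1 : (1 <= w)%N) (G : network w)
    (k : lnc D G) (k_causal : causal z k)
    (f : channel G -> 'cV[D]_w) (f_coding : is_coding_vectors k f)
    (v : node G) (v_decodable : exists delta : nat, decodable z f v delta) :
  (exists i : 'I_w -> nat, invariant_valuations z (coding_span f v) i) /\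
  (forall i : 'I_w -> nat, invariant_valuations z (coding_span f v) i ->
     is_min_decoding_delay z f v (\max_(j < w) i j)%N).
Proof.
have [_ _ D_nfield] := D_dvr.
have z_neq0 := uniformizer_neq0 z_unif D_nfield.
split=> [|i i_inv].
  have [m /decodableP span_m] := v_decodable.
  apply: exists_invariant_valuations span_m => //.
  exact: coding_span_submodule.
(* The delays are thus the upper bounds of the valuations, and the least of these is the maximum. *)
have delayP m : decodable z f v m <-> forall j, (i j <= m)%N.
  by rewrite decodableP; apply: invariant_valuations_leq.
split=> [|m /delayP le_im]; first by apply/delayP => j; apply: leq_bigmax.
by apply/bigmax_leqP => j _.
Qed.
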